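(* Let $(S,s)$ be a finite commutative non-degenerate solution. Then the action of the associated permutation group $\mathcal{G}(S,s)$ on $S$ is semi-regular.
   Context: A solution (set-theoretic solution of the Pentagon Equation) is a pair $(S,s)$ with $S$ a non-empty set and $s:S\times S\to S\times S$ a map such that $s_{23}s_{13}s_{12}=s_{12}s_{23}$ as maps $S^3\to S^3$, where $s_{12}=s\times \mathrm{id}$, $s_{23}=\mathrm{id}\times s$, $s_{13}=(\tau\times \mathrm{id})(\mathrm{id}\times s)(\tau\times \mathrm{id})$ and $\tau(x,y)=(y,x)$. Writing $s(x,y)=(x\cdot y,\theta_x(y))$, the pair $(S,s)$ is a solution if and only if for all $x,y,z\in S$: $(x\cdot y)\cdot z=x\cdot(y\cdot z)$, $\theta_x(y)\cdot\theta_{x\cdot y}(z)=\theta_x(y\cdot z)$, and $\theta_{\theta_x(y)}\theta_{x\cdot y}=\theta_y$. It is finite if $S$ is finite. It is commutative if $s_{12}s_{13}=s_{13}s_{12}$, equivalently $x\cdot y\cdot z=x\cdot z\cdot y$ and $\theta_{x\cdot y}=\theta_x$ for all $x,y,z\in S$. It is non-degenerate if every $\theta_x:S\to S$ is bijective. For a non-degenerate solution, the associated permutation group $\mathcal{G}(S,s)$ is the subgroup of $\mathrm{Sym}(S)$ generated by $\{\theta_x: x\in S\}$. A permutation group acting on $S$ is semi-regular if $g(z)=g'(z)$ for group elements $g,g'$ and some $z\in S$ implies $g=g'$ (every point has trivial stabilizer). *)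

(* Defs.v *)
From mathcomp Require Import all_boot all_fingroup.

Set Implicit Arguments.
Unset Strict Implicit.
Unset Printing Implicit Defensive.

Local Open Scope group_scope.

Section Pentagon.

Variable S : Type.
Implicit Type s : S * S -> S * S.

(* [S * S * S] parses as [(S * S) * S], so [id x s] has to reassociate. *)
Definition s12 s (p : S * S * S) : S * S * S :=
  let: (x, y, z) := p in (s (x, y), z).

Definition s23 s (p : S * S * S) : S * S * S :=
  let: (x, y, z) := p in let: (y', z') := s (y, z) in (x, y', z').

Definition tau (p : S * S) : S * S := (p.2, p.1).

Definition s13 s : S * S * S -> S * S * S := s12 tau \o s23 s \o s12 tau.

Definition solution s : Prop :=
  inhabited S /\ s23 s \o s13 s \o s12 s =1 s12 s \o s23 s.

Definition commutative_solution s : Prop := s12 s \o s13 s =1 s13 s \o s12 s.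

Definition theta s (x y : S) : S := (s (x, y)).2.

Definition nondegenerate s : Prop := forall x, bijective (theta s x).

End Pentagon.

(* In [{perm S}] the product [g * h] is "first g, then h", the opposite of the
   usual composition in Sym(S); a subset generates the same set of permutations
   under either convention. *)
Definition permutation_group (S : finType) (s : S * S -> S * S)
    (nd : nondegenerate s) : {group {perm S}} :=
  <<[set perm (bij_inj (nd x)) | x : S]>>%G.

(* For the natural action of a set of permutations; distinct from
   [frobenius.semiregular], which is about conjugation inside a group. *)
Definition semi_regular (S : finType) (G : {set {perm S}}) : Prop :=
  forall (g g' : {perm S}) (z : S),
    g \in G -> g' \in G -> g z = g' z -> g = g'.

(* Main.v *)
Require Import Defs.
From mathcomp Require Import all_boot all_fingroup.

(** Write [s (x, y) = (x . y, theta_x y)].  Commutativity gives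
    [theta_(x . y) = theta_x], which turns the last component of the pentagon
    equation into [theta_(theta_x y) \o theta_x = theta_y]
    (lemma [theta_theta]).  This identity alone carries the proof, in two ways.

    It makes the set of generators [theta_x] a group already: taking [y = x]
    shows that the identity is one of them, and since [theta_x] is surjective,
    every composite [theta_w \o theta_x] is of the form
    [theta_(theta_x y) \o theta_x = theta_y] (lemma [group_set_theta_perm]).
    Thus every element of the permutation group is some [theta_x].

    Moreover it recovers [theta_x] from any one of its values: by cancellation,
    [theta_x] is determined by [theta_z] and [theta_(theta_x z)], hence by [z]
    and [theta_x z] (lemma [theta_perm_inj_at]). *)

Local Open Scope group_scope.

Lemma theta_mul (S : Type) (s : S * S -> S * S) (x y z : S) :
  commutative_solution s -> theta s (s (x, y)).1 z = theta s x z.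
Proof.
move=> /(_ (x, y, z)); rewrite /s13 /s23 /s12 /tau /theta /=.
by case: (s (x, y)) => a b /=; case: (s (x, z)) (s (a, z)) => [c d] [e f] /= [].
Qed.

(** Comparing third components in the pentagon equation gives
    [theta_(theta_x y) \o theta_(x . y) = theta_y], and the inner index [x . y]
    reduces to [x] by commutativity. *)
Lemma theta_theta (S : Type) (s : S * S -> S * S) (x y z : S) :
  solution s -> commutative_solution s ->
  theta s (theta s x y) (theta s x z) = theta s y z.
Proof.
move=> [_ /(_ (x, y, z)) pent] hc; rewrite -(theta_mul S s x y z hc).
move: pent; rewrite /s13 /s23 /s12 /tau /theta /=.
case: (s (x, y)) => a b /=; case: (s (a, z)) => c d /=.
by case: (s (b, d)) (s (y, z)) => [e f] [g h] /=; case: (s (x, g)) => ? ? [].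
Qed.

Section ThetaPermutations.

Variables (S : finType) (s : S * S -> S * S).
Hypotheses (hs : solution s) (hc : commutative_solution s).
Hypothesis nd : nondegenerate s.

Definition theta_perm (x : S) : {perm S} := perm (bij_inj (nd x)).

Lemma theta_permM (x y : S) :
  theta_perm x * theta_perm (theta_perm x y) = theta_perm y.
Proof. by apply/permP => z; rewrite permM !permE (theta_theta S s x y z hs hc). Qed.

Lemma group_set_theta_perm : group_set [set theta_perm x | x : S].
Proof.
apply/group_setP; split=> [|_ _ /imsetP[x _ ->] /imsetP[w _ ->]].
  have [[x] _] := hs; apply/imsetP; exists (theta_perm x x) => //.
  by apply: (mulgI (theta_perm x)); rewrite mulg1 theta_permM.
apply/imsetP; exists ((theta_perm x)^-1 w) => //.
by rewrite -(theta_permM x ((theta_perm x)^-1 w)) permKV.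
Qed.

(** With [z] and [theta_x z] given, [theta_permM] reads
    [theta_x = theta_z * theta_(theta_x z)^-1]. *)
Lemma theta_perm_inj_at (x y z : S) :
  theta_perm x z = theta_perm y z -> theta_perm x = theta_perm y.
Proof.
move=> exy; apply: (mulIg (theta_perm (theta_perm x z))).
by rewrite theta_permM exy theta_permM.
Qed.

End ThetaPermutations.

Theorem theorem8 (S : finType) (s : S * S -> S * S)
    (hs : solution s) (hc : commutative_solution s) (nd : nondegenerate s) :
  semi_regular (permutation_group nd).
Proof.
move=> g g' z; rewrite /= (gen_set_id (group_set_theta_perm S s hs hc nd)).
by move=> /imsetP[x _ ->] /imsetP[y _ ->] /theta_perm_inj_at->.
Qed.
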